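(* Let $\mathfrak{g}$ be a curved $L_\infty$-algebra equipped with a descending, bounded above and complete filtration $\mathfrak{g}=\mathfrak{F}_1\mathfrak{g}\supset \mathfrak{F}_2\mathfrak{g}\supset \mathfrak{F}_3\mathfrak{g}\supset\cdots$ compatible with the curved $L_\infty$-algebra structure. If there exists an integer $r\in\mathbb{N}_0$ such that the curvature $\mu_0$ of $\mathfrak{g}$ satisfies $\mu_0\in\mathfrak{F}_{2r+1}\mathfrak{g}$ and the $(r+1)$-st page of the spectral sequence of $\mathfrak{g}$ vanishes in total degree $2$, i.e. $E_{r+1}^{p,q}=0$ for all $p,q$ with $p+q=2$, then there exists a Maurer-Cartan element $\alpha\in \mathrm{MC}(\mathfrak{g})$ with $\alpha\in\mathfrak{F}_{r+1}\mathfrak{g}$.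
   Context: Vector spaces are $\mathbb{Z}$-graded over a field $\mathbb{K}$ of characteristic $0$, with cohomological conventions. For a graded vector space $\mathfrak{g}$, $\mathfrak{g}[-1]$ denotes the shift with $(\mathfrak{g}[-1])^k=\mathfrak{g}^{k+1}$. A curved $L_\infty$-algebra structure on $\mathfrak{g}$ is a collection of degree $1$ linear maps $\mu_n:S^n(\mathfrak{g}[-1])\to\mathfrak{g}[-1]$, $n\ge 0$, satisfying for all $n\geq 0$ and homogeneous $x_1,\dots,x_n \in \mathfrak{g}[-1]$ $$\sum_{i+j=n,\ i,j\ge 0}\ \sum_{\sigma\in \mathrm{UnSh}(i,j)}\epsilon(\sigma,x_1,\dots,x_n)\,\mu_{j+1}\big(\mu_i(x_{\sigma(1)},\dots,x_{\sigma(i)}),x_{\sigma(i+1)},\dots,x_{\sigma(n)}\big)=0,$$ where $\mathrm{UnSh}(i,j)$ is the set of $(i,j)$-unshuffles and $\epsilon$ is the Koszul sign for the elements viewed in $\mathfrak{g}[-1]$. The element $\mu_0\in(\mathfrak{g}[-1])^1=\mathfrak{g}^2$ is the curvature. In terms of $\mathfrak{g}$, $\mu_1$ is a map $\mathfrak{g}^k\to\mathfrak{g}^{k+1}$. Filtration: descending and bounded above means $\mathfrak{g}=\mathfrak{F}_1\mathfrak{g}\supset\mathfrak{F}_2\mathfrak{g}\supset\cdots$ (put $\mathfrak{F}_p\mathfrak{g}=\mathfrak{g}$ for $p\le 1$), complete means $\mathfrak{g}=\varprojlim_p \mathfrak{g}/\mathfrak{F}_p\mathfrak{g}$, and compatible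 means that $x_i\in\mathfrak{F}_{k_i}\mathfrak{g}$ for $i=1,\dots,n$ implies $\mu_n(x_1,\dots,x_n)\in\mathfrak{F}_{k_1+\cdots+k_n}\mathfrak{g}$. Maurer-Cartan elements: $\mathrm{MC}(\mathfrak{g})$ is the set of $\alpha\in\mathfrak{g}^1=(\mathfrak{g}[-1])^0$ with $\sum_{k\ge 0}\frac{1}{k!}\mu_k(\alpha,\dots,\alpha)=0$. Spectral sequence: although $\mu_1^2(x)=-\mu_2(\mu_0,x)$ need not vanish, if $\mu_0\in\mathfrak{F}_{2r+1}\mathfrak{g}$ then for $s\le r+1$ one defines $$E_s^{p,q}=\frac{\{z\in\mathfrak{F}_p\mathfrak{g}^{p+q}:\mu_1(z)\in\mathfrak{F}_{p+s}\mathfrak{g}^{p+q+1}\}}{\{x\in\mathfrak{F}_{p+1}\mathfrak{g}^{p+q}:\mu_1(x)\in\mathfrak{F}_{p+s}\mathfrak{g}^{p+q+1}\}+\{\mu_1(y): y\in\mathfrak{F}_{p-s+1}\mathfrak{g}^{p+q-1},\ \mu_1(y)\in\mathfrak{F}_p\mathfrak{g}^{p+q}\}}.$$ Thus $E_{r+1}^{p,q}=0$ means: for every $x\in\mathfrak{F}_p\mathfrak{g}^{p+q}$ with $\mu_1(x)\in\mathfrak{F}_{p+r+1}\mathfrak{g}^{p+q+1}$ there is $y\in\mathfrak{F}_{p-r}\mathfrak{g}^{p+q-1}$ with $\mu_1(y)\in\mathfrak{F}_p\mathfrak{g}^{p+q}$ and $x-\mu_1(y)\in\mathfrak{F}_{p+1}\mathfrak{g}^{p+q}$.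 *)

(* Defs.v *)
From mathcomp Require Import all_boot all_order all_fingroup all_algebra.
From mathcomp Require Import classical_sets.

Set Implicit Arguments.
Unset Strict Implicit.
Unset Printing Implicit Defensive.

Import Order.TTheory GRing.Theory Num.Theory.

Local Open Scope classical_set_scope.
Local Open Scope ring_scope.

Definition subspace (K : fieldType) (V : lmodType K) (A : set V) : Prop :=
  A 0 /\ forall (a : K) (x y : V), A x -> A y -> A (a *: x + y).

(* The underlying vector space is the direct sum of the subspaces [part k]. *)
Record gradedVect (K : fieldType) := GradedVect {
  gsort :> lmodType K;
  part : int -> set gsort;
  part_subspace : forall k, subspace (part k);
  part_span : forall x : gsort, exists (ks : seq int) (c : int -> gsort),
    (forall k, part k (c k)) /\ x = \sum_(k <- ks) c k;
  part_direct : forall (ks : seq int) (c : int -> gsort),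
    uniq ks -> (forall k, part k (c k)) -> \sum_(k <- ks) c k = 0 ->
    forall k, k \in ks -> c k = 0 }.

Arguments part {K} g k : rename.

(* Homogeneous elements of g[-1], with the convention (g[-1])^k = g^(k+1). *)
Definition shift_part (K : fieldType) (g : gradedVect K) (k : int) : set g :=
  part g (k + 1).

Arguments shift_part {K} g k.

(* Koszul sign of x_1 ... x_n = eps * x_(s 1) ... x_(s n), for x_i of degree
   [d i]: each inversion of s contributes one transposition sign. *)
Definition koszul (K : fieldType) (n : nat) (d : 'I_n -> int) (s : 'S_n) : K :=
  \prod_(a < n) \prod_(b < n | (a < b)%N && (s b < s a)%N)
    (-1) ^ (d (s a) * d (s b)).

(* (i, n - i)-unshuffles. *)
Definition unshuffle (n i : nat) (s : 'S_n) : bool :=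
  [forall a : 'I_n, forall b : 'I_n,
    ((a < b)%N && ((b < i)%N || (i <= a)%N)) ==> (s a < s b)%N].

(* All brackets are packed in one map on finite sequences:
   mu_n (x_1, ..., x_n) is [mu [:: x_1; ...; x_n]]. In particular the curvature
   is [mu [::]] and mu_1 x is [mu [:: x]]. The maps [mu] restricted to sequences
   of length n, being multilinear and graded symmetric for the degrees of g[-1],
   are the linear maps on S^n (g[-1]). *)
Record curvedLinfty (K : fieldType) := CurvedLinfty {
  cspace :> gradedVect K;
  mu : seq cspace -> cspace;
  mu_linear : forall (s1 s2 : seq cspace) (a : K) (x y : cspace),
    mu (s1 ++ (a *: x + y) :: s2) =
      a *: mu (s1 ++ x :: s2) + mu (s1 ++ y :: s2);
  mu_sym : forall (s1 s2 : seq cspace) (k l : int) (x y : cspace),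
    shift_part cspace k x -> shift_part cspace l y ->
    mu (s1 ++ x :: y :: s2) = ((-1) ^ (k * l) : K) *: mu (s1 ++ y :: x :: s2);
  mu_degree : forall (n : nat) (d : 'I_n -> int) (x : 'I_n -> cspace),
    (forall i, shift_part cspace (d i) (x i)) ->
    shift_part cspace (\sum_(i < n) d i + 1) (mu [seq x i | i <- enum 'I_n]);
  mu_relation : forall (n : nat) (d : 'I_n -> int) (x : 'I_n -> cspace),
    (forall i, shift_part cspace (d i) (x i)) ->
    \sum_(i < n.+1) \sum_(s : 'S_n | unshuffle i s)
      koszul K d s *:
        mu (mu [seq x (s k) | k : 'I_n <- enum 'I_n & (k < i)%N] ::
            [seq x (s k) | k : 'I_n <- enum 'I_n & (i <= k)%N]) = 0 }.

Arguments mu {K} c s : rename.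

(* Descending filtrations by graded subspaces, with F_p g = g for p <= 1. *)
Record filtration (K : fieldType) (g : gradedVect K) := Filtration {
  fil :> int -> set g;
  fil_subspace : forall p, subspace (fil p);
  fil_graded : forall p (x : g), fil p x ->
    exists (ks : seq int) (c : int -> g),
      (forall k, part g k (c k) /\ fil p (c k)) /\ x = \sum_(k <- ks) c k;
  fil_desc : forall p, fil (p + 1) `<=` fil p;
  fil_bounded : forall p, p <= 1 -> fil p = setT }.

Section Filtered.
Variables (K : fieldType) (g : curvedLinfty K) (F : filtration g).

(* F_p g^k *)
Definition fpart (p k : int) : set g := F p `&` part g k.

(* g = lim_p g / F_p g in graded vector spaces, i.e. degree by degree: every
   compatible family of classes x_p + F_p g^k comes from exactly one y in g^k. *)
Definition complete : Prop :=
  forall (k : int) (x : int -> g),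
    (forall p, part g k (x p)) -> (forall p, F p (x (p + 1) - x p)) ->
    exists! y : g, part g k y /\ forall p, F p (y - x p).

Definition compatible : Prop :=
  forall (n : nat) (k : 'I_n -> int) (x : 'I_n -> g),
    (forall i, F (k i) (x i)) ->
    F (\sum_(i < n) k i) (mu g [seq x i | i <- enum 'I_n]).

(* Convergence of a series in the topology defined by the filtration. *)
Definition series_to (u : nat -> g) (l : g) : Prop :=
  forall p : int, exists N : nat, forall n : nat, (N <= n)%N ->
    F p (\sum_(k < n) u k - l).

Definition MC : set g := [set alpha |
  part g 1 alpha /\
  series_to (fun k => (k`!%:R^-1 : K) *: mu g (nseq k alpha)) 0].

Definition Enum (s : nat) (p q : int) : set g :=
  [set z | fpart p (p + q) z /\ fpart (p + s%:Z) (p + q + 1) (mu g [:: z])].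

Definition Eden (s : nat) (p q : int) : set g :=
  [set x + w |
    x in [set x | fpart (p + 1) (p + q) x /\
                  fpart (p + s%:Z) (p + q + 1) (mu g [:: x])] &
    w in [set mu g [:: y] |
           y in [set y | fpart (p - s%:Z + 1) (p + q - 1) y /\
                         fpart p (p + q) (mu g [:: y])]]].

(* The underlying set of the quotient Enum / Eden, as a set of cosets. It is a
   vector space only when Eden `<=` Enum, e.g. if mu_0 is in F_(2r+1) g and
   s <= r + 1. *)
Definition Epage (s : nat) (p q : int) : set (set g) :=
  [set [set z + b | b in Eden s p q] | z in Enum s p q].

(* E_s^(p,q) = 0: its only element is the zero class, which is Eden itself. *)
Definition Epage_zero (s : nat) (p q : int) : Prop :=
  Epage s p q = [set Eden s p q].

End Filtered.

(* Main.v *)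
Require Import Defs.
From mathcomp Require Import all_boot all_order all_fingroup all_algebra.
From mathcomp Require Import boolp classical_sets.
From mathcomp Require Import zify.
Import GRing.Theory.
Local Open Scope ring_scope.

Set Implicit Arguments.
Unset Strict Implicit.
Unset Printing Implicit Defensive.

Import Order.TTheory.

(** The Maurer-Cartan equation is solved by a Newton-like iteration. Write
    R(x) = sum_k mu_k(x, ..., x) / k! and let x in F_(r+1) g^1 be an approximate
    solution, R(x) in F_m with m >= 2r+1; since R(0) = mu_0, the start is x = 0
    and m = 2r+1.

    - The Bianchi identity sum_k mu_(k+1)(R(x), x, ..., x) / k! = 0 shows that
      mu_1(R(x)) is in F_(m+r+1), because each other term contains R(x) and at
      least one x. So R(x) is a cycle of the page E_(r+1), in total degree 2.
    - As this page vanishes there, R(x) = mu_1(y) modulo F_(m+1) for some y in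
      F_(m-r) g^1, and m - r >= r + 1.
    - In R(x - y) - R(x) + mu_1(y) every term comes from a bracket with at least
      two entries, one of them y and the others in F_(r+1). Hence it lies in
      F_((m-r)+(r+1)) = F_(m+1), and so does R(x - y).

    The approximations thus obtained form a Cauchy sequence, since the
    corrections y tend to 0, and their limit is a Maurer-Cartan element.

    R(x) is an infinite series in g^2, and it is replaced throughout by its
    truncation mc_trunc N x: as g = F_1 g, the terms of index k >= N lie in F_N,
    so that membership of R(x) in F_p only depends on a truncation with N >= p.
    The Bianchi identity then holds modulo F_N (bianchi_trunc). It comes from the
    L_infinity relations evaluated on x, ..., x, where x has degree 0 in g[-1]:
    all Koszul signs are 1, the (i, n-i)-unshuffles all give the same term, and
    their number n! / (i! (n-i)!) (card_unshuffle) produces, after division by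
    n!, the coefficients of the exponential series. The iteration step is
    mc_trunc_improve. *)

(** * Counting unshuffles *)

Section Unshuffles.

Lemma sorted_enum_set (n : nat) (A : {set 'I_n}) :
  sorted (fun a b : 'I_n => (a < b)%N) (enum A).
Proof.
rewrite /enum_mem -enumT; apply: sorted_filter; first by move=> a b c; apply: ltn_trans.
by have := iota_ltn_sorted 0 n; rewrite -val_enum_ord sorted_map.
Qed.

(** Both [map s (enum A)] and [map t (enum A)] are the increasing enumeration of
    the common image. *)
Lemma eq_in_increasing (n : nat) (A : {set 'I_n}) (s t : 'S_n) :
  {in A &, {homo s : a b / (a < b)%N}} -> {in A &, {homo t : a b / (a < b)%N}} ->
  s @: A = t @: A -> {in A, s =1 t}.
Proof.
move=> s_incr t_incr stA a Aa.
have sorted_image (u : 'S_n) : {in A &, {homo u : a b / (a < b)%N}} ->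
    sorted (fun a b : 'I_n => (a < b)%N) (map u (enum A)).
  move=> u_incr; apply: (homo_sorted_in (P := mem A)) (sorted_enum_set A).
    by move=> b c Ab Ac; apply: u_incr.
  by apply/allP => b; rewrite mem_enum.
have/eq_in_map : map s (enum A) = map t (enum A).
  apply: (irr_sorted_eq _ _ (sorted_image _ s_incr) (sorted_image _ t_incr)).
  - by move=> b c d; apply: ltn_trans.
  - by move=> b; apply: ltnn.
  - move=> b; have/setP/(_ b) := stA.
    have image (u : 'S_n) : (b \in map u (enum A)) = (b \in u @: A).
      apply/mapP/imsetP => -[c]; rewrite ?mem_enum => Ac ->; exists c => //.
      by rewrite mem_enum.
    by rewrite !image.
by apply; rewrite mem_enum.
Qed.

Lemma unshuffleP (n i : nat) (s : 'S_n) :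
  reflect (forall a b : 'I_n, (a < b)%N -> (b < i)%N || (i <= a)%N -> (s a < s b)%N)
          (unshuffle i s).
Proof.
apply: (iffP forallP) => [us a b ab iab | us a].
  by have /forallP/(_ b)/implyP := us a; apply; rewrite ab.
by apply/forallP => b; apply/implyP => /andP[ab iab]; apply: us.
Qed.

(** An unshuffle increases on the first [i] positions and on the others, so its
    values there are determined by the image of each block, and the second image
    is the complement of the first. *)
Lemma unshuffle_inj (n i : nat) :
  {in [set s : 'S_n | unshuffle i s] &,
    injective (fun s : 'S_n => s @: [set a : 'I_n | (a < i)%N])}.
Proof.
move=> s t; rewrite !inE => /unshuffleP us /unshuffleP ut stL.
set L := [set a : 'I_n | (a < i)%N] in stL.
have stLC : s @: (~: L) = t @: (~: L).
  have imC (u : 'S_n) : u @: (~: L) = ~: (u @: L).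
    apply/setP => b; rewrite inE -[b](permKV u) !mem_imset ?inE //; exact: perm_inj.
  by rewrite !imC stL.
apply/permP => a; have [La|nLa] := boolP (a \in L).
  apply: (@eq_in_increasing n L) => // b c; rewrite !inE => bi ci bc.
    by apply: us => //; rewrite ci.
  by apply: ut => //; rewrite ci.
apply: (@eq_in_increasing n (~: L)) => [b c|b c||] //; last by rewrite inE.
  by rewrite !inE -!leqNgt => bi ci bc; apply: us => //; rewrite bi orbT.
by rewrite !inE -!leqNgt => bi ci bc; apply: ut => //; rewrite bi orbT.
Qed.

Lemma size_filter_ord_ltn (n i : nat) :
  (i <= n)%N -> size [seq a : 'I_n <- enum 'I_n | (a < i)%N] = i.
Proof.
move=> i_n; rewrite size_filter -(count_map val (fun k => k < i)%N) val_enum_ord.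
by rewrite -size_filter (@filter_iota_ltn 0 n i) // size_iota.
Qed.

(** The unshuffle lists [A] in increasing order, then the complement of [A]. *)
Lemma unshuffle_surj (n : nat) (A : {set 'I_n}) :
  exists2 s : 'S_n, unshuffle #|A| s & s @: [set a : 'I_n | (a < #|A|)%N] = A.
Proof.
set i := #|A|; pose u := enum A ++ enum (~: A).
have size_u : size u = n by rewrite size_cat -!cardE cardsC card_ord.
have uniq_u : uniq u.
  rewrite cat_uniq !enum_uniq andbT /=; apply/hasPn => a.
  by rewrite !mem_enum inE.
have nth_inj : injective (fun a : 'I_n => nth a u a).
  move=> a b; rewrite (set_nth_default a b) ?size_u // => /eqP.
  by rewrite nth_uniq ?size_u // => /eqP/val_inj.
pose s := perm nth_inj.
have sL (a : 'I_n) : (a < i)%N -> s a = nth a (enum A) a.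
  by move=> ai; rewrite permE nth_cat -cardE ai.
have sR (a : 'I_n) : (i <= a)%N -> s a = nth a (enum (~: A)) (a - i).
  by move=> ai; rewrite permE nth_cat -cardE ltnNge ai.
exists s.
  apply/unshuffleP => a b ab /orP[bi|ia].
    rewrite (sL a (ltn_trans ab bi)) (sL b bi) (set_nth_default a b) -?cardE //.
    apply: (sorted_ltn_nth _ a (sorted_enum_set A)) => //.
    - by move=> c d e; apply: ltn_trans.
    - by rewrite inE -cardE (ltn_trans ab bi).
    - by rewrite inE -cardE.
  have ib : (i <= b)%N := leq_trans ia (ltnW ab).
  have size_AC : size (enum (~: A)) = (n - i)%N.
    by rewrite -cardE cardsCs finset.setCK card_ord.
  have bn := ltn_ord b; have an := ltn_ord a.
  rewrite (sR a ia) (sR b ib) (set_nth_default a b) ?size_AC; last by lia.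
  apply: (sorted_ltn_nth _ a (sorted_enum_set (~: A))); rewrite ?inE ?size_AC; try lia.
  by move=> c d e; apply: ltn_trans.
apply/eqP; rewrite eqEcard; apply/andP; split.
  apply/fintype.subsetP => b /imsetP[a]; rewrite inE => ai ->.
  by rewrite sL // -mem_enum mem_nth // -cardE.
rewrite card_imset; last exact: perm_inj.
have := max_card (mem A); rewrite card_ord -/i => i_n.
by rewrite cardsE cardE /enum_mem -enumT size_filter_ord_ltn.
Qed.

Lemma card_unshuffle (n i : nat) :
  (i <= n)%N -> #|[set s : 'S_n | unshuffle i s]| = 'C(n, i).
Proof.
move=> i_n; rewrite -(card_in_imset (@unshuffle_inj n i)).
rewrite -[n in 'C(n, _)](card_ord n) -card_draws; apply: eq_card => A.
rewrite !inE; apply/imsetP/eqP => [[s _ ->]|cardA]; last first.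
  by have [s us sA] := unshuffle_surj A; exists s; rewrite ?inE -cardA.
rewrite card_imset; last exact: perm_inj.
by rewrite cardsE cardE /enum_mem -enumT size_filter_ord_ltn.
Qed.

End Unshuffles.

(** * Subspaces and filtrations *)

Section Subspaces.

Variables (K : fieldType) (V : lmodType K) (A : set V) (subA : subspace A).

Lemma subspace0 : A 0. Proof. by case: subA. Qed.

Lemma subspaceZ (a : K) (x : V) : A x -> A (a *: x).
Proof. by case: subA => A0 AZD Ax; rewrite -[_ *: _]addr0; apply: AZD. Qed.

Lemma subspaceD (x y : V) : A x -> A y -> A (x + y).
Proof. by case: subA => _ AZD Ax Ay; rewrite -[x]scale1r; apply: AZD. Qed.

Lemma subspaceN (x : V) : A x -> A (- x).
Proof. by rewrite -scaleN1r; apply: subspaceZ. Qed.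

Lemma subspaceB (x y : V) : A x -> A y -> A (x - y).
Proof. by move=> Ax Ay; apply: subspaceD => //; apply: subspaceN. Qed.

Lemma subspace_sum (I : Type) (s : seq I) (P : pred I) (f : I -> V) :
  (forall i, P i -> A (f i)) -> A (\sum_(i <- s | P i) f i).
Proof.
by move=> Af; elim/big_ind: _ => //; [apply: subspace0 | apply: subspaceD].
Qed.

Lemma subspace_subK (x y : V) : A (x - y) -> A y -> A x.
Proof. by move=> Axy Ay; rewrite -(subrK y x); apply: subspaceD. Qed.

End Subspaces.

Section Filtered.

Variables (K : fieldType) (g : curvedLinfty K) (F : filtration g).

Lemma fil_anti (p q : int) : p <= q -> (F q `<=` F p)%classic.
Proof.
move=> pq; have -> : q = p + `|q - p|%N%:Z by lia.
elim: `|q - p|%N => [|n IHn]; first by rewrite addr0.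
apply: subset_trans IHn; have -> : p + n.+1%:Z = p + n%:Z + 1 by lia.
exact: fil_desc.
Qed.

Lemma fil1T (x : g) : F 1 x.
Proof. by rewrite fil_bounded. Qed.

(** * Brackets: linearity, degree and filtration *)

Lemma mu_sum (I : Type) (t : seq I) (P : pred I) (c : I -> K) (f : I -> g) (s : seq g) :
  mu g ((\sum_(i <- t | P i) c i *: f i) :: s) =
    \sum_(i <- t | P i) c i *: mu g (f i :: s).
Proof.
have mu0 : mu g (0 :: s) = 0.
  by have := mu_linear [::] s (-1) (0 : g) 0; rewrite /= scaler0 addr0 scaleN1r addNr.
elim: t => [|i t IHt]; first by rewrite !big_nil mu0.
rewrite !big_cons; case: (P i) => //.
by have := mu_linear [::] s (c i) (f i) (\sum_(j <- t | P j) c j *: f j); rewrite /= IHt.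
Qed.

Lemma mu_nseq0 (k : nat) : mu g (nseq k.+1 0) = 0.
Proof.
have := @mu_sum nat [::] xpredT (fun=> 0) (fun=> 0) (nseq k 0).
by rewrite !big_nil.
Qed.

(** The shift is 2: one for the degree of the brackets, one for the passage from
    g[-1] to g. *)
Lemma mu_part (d : seq int) (s : seq g) :
  size d = size s -> (forall i, (i < size s)%N -> part g (nth 0 d i + 1) (nth 0 s i)) ->
  part g (\sum_(k <- d) k + 2) (mu g s).
Proof.
move=> size_ds part_s.
have := @mu_degree K g (size s) (fun i => nth 0 d i) (tnth (in_tuple s)).
rewrite map_tnth_enum /= /shift_part -addrA (big_nth 0) big_mkord size_ds; apply=> i.
by rewrite (tnth_nth 0); apply: part_s.
Qed.

Hypothesis F_compatible : compatible F.

Lemma mu_fil (k : seq int) (s : seq g) :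
  size k = size s -> (forall i, (i < size s)%N -> F (nth 0 k i) (nth 0 s i)) ->
  F (\sum_(p <- k) p) (mu g s).
Proof.
move=> size_ks F_s.
have := @F_compatible (size s) (fun i => nth 0 k i) (tnth (in_tuple s)).
rewrite map_tnth_enum /= (big_nth 0) big_mkord size_ks; apply=> i.
by rewrite (tnth_nth 0); apply: F_s.
Qed.

Lemma mu_fil_insert (j l : nat) (a b : int) (x y z : g) :
  F a x -> F a y -> F b z ->
  F (b + a *+ (j + l)%N) (mu g (nseq j x ++ z :: nseq l y)).
Proof.
move=> Fx Fy Fz; have := @mu_fil (nseq j a ++ b :: nseq l a) (nseq j x ++ z :: nseq l y).
rewrite big_cat big_cons !big_nseq !iter_addr_0 /= addrCA -mulrnDr.
rewrite !size_cat /= !size_nseq; apply=> // i ijl.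
rewrite !nth_cat !size_nseq; case: ltnP => ij; first by rewrite !nth_nseq ij.
case: (i - j)%N (ltac:(lia) : (i - j < l.+1)%N) => [|k] //=.
by rewrite ltnS => kl; rewrite !nth_nseq kl.
Qed.

Lemma mu_fil_cons (k : nat) (a b : int) (x z : g) :
  F a x -> F b z -> F (b + a *+ k) (mu g (z :: nseq k x)).
Proof. by move=> Fx; apply: (mu_fil_insert 0 k Fx Fx). Qed.

Lemma mu_fil_nseq (k : nat) (x : g) : F k%:Z (mu g (nseq k x)).
Proof.
case: k => [|k]; first by rewrite fil_bounded.
apply: fil_anti (mu_fil_cons k (fil1T x) (fil1T x)); lia.
Qed.

(** Replacing [y] by [x] one entry at a time, each replacement changes the bracket
    by one that contains [x - y] once and [x] or [y] in the [k] other places. *)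
Lemma mu_fil_sub (k : nat) (a b : int) (x y : g) :
  F a x -> F a y -> F b (x - y) ->
  F (b + a *+ k) (mu g (nseq k.+1 x) - mu g (nseq k.+1 y)).
Proof.
move=> Fx Fy Fxy.
have hybrid (j l : nat) : (j + l)%N = k.+1 ->
    F (b + a *+ k) (mu g (nseq j x ++ nseq l y) - mu g (nseq k.+1 y)).
  elim: j l => [|j IHj] l.
    by rewrite add0n => ->; rewrite subrr; apply: subspace0; apply: fil_subspace.
  rewrite addSnnS => jl.
  rewrite -(subrK (mu g (nseq j x ++ nseq l.+1 y)) (mu g _)) -addrA.
  apply: subspaceD (IHj _ jl); first exact: fil_subspace.
  have := mu_linear (nseq j x) (nseq l y) (-1) y x.
  rewrite !scaleN1r [- y + x]addrC => E.
  have -> : nseq j.+1 x = nseq j x ++ [:: x] by rewrite -[j.+1]addn1 nseqD.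
  rewrite -catA [X in F _ X]addrC -E.
  have <- : (j + l)%N = k by lia.
  exact: mu_fil_insert.
by have := hybrid k.+1 0%N (addn0 _); rewrite cats0.
Qed.

(** * The truncated Maurer-Cartan series *)

Definition mc_trunc (N : nat) (x : g) : g :=
  \sum_(k < N) (k`!%:R^-1 : K) *: mu g (nseq k x).

(** The terms of index at least [p] lie in [F p], since g = F_1 g. *)
Lemma mc_trunc_fil (p M N : nat) (x : g) :
  (p <= M)%N -> (p <= N)%N -> F p%:Z (mc_trunc M x) -> F p%:Z (mc_trunc N x).
Proof.
have split_trunc (L : nat) : (p <= L)%N ->
    F p%:Z (mc_trunc L x) <-> F p%:Z (mc_trunc p x).
  have subF := fil_subspace F p%:Z.
  move=> pL; have tail : F p%:Z (mc_trunc L x - mc_trunc p x).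
    rewrite /mc_trunc -!(big_mkord xpredT (fun k => (k`!%:R^-1 : K) *: mu g (nseq k x))).
    rewrite (big_cat_nat (leq0n p) pL) /= [X in F _ X]addrC addKr big_nat_cond.
    apply: subspace_sum => // k; rewrite andbT => /andP[pk _]; apply: subspaceZ => //.
    by apply: fil_anti (mu_fil_nseq k x); lia.
  split=> [|Fp]; last exact: subspace_subK tail Fp.
  by apply: subspace_subK => //; rewrite -opprB; apply: subspaceN.
by move=> pM pN /(split_trunc _ pM)/(split_trunc _ pN).
Qed.

Lemma mc_trunc_part (N : nat) (x : g) : part g 1 x -> part g 2 (mc_trunc N x).
Proof.
move=> x1; apply: subspace_sum => [|k _]; first exact: part_subspace.
apply: subspaceZ; first exact: part_subspace.
have := @mu_part (nseq k 0) (nseq k x).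
rewrite big_nseq iter_addr_0 mul0rn add0r !size_nseq; apply=> // i ik.
by rewrite !nth_nseq ik.
Qed.

Hypothesis charK0 : [pchar K] =i pred0.

(** As [x] has degree 0 in g[-1], there are no signs and the 'C(n, i) unshuffles
    contribute equal terms; division by n! gives the coefficients below. *)
Lemma mu_relation_diag (n : nat) (x : g) : part g 1 x ->
  \sum_(i < n.+1) ((i`!%:R^-1 : K) * (n - i)`!%:R^-1) *:
    mu g (mu g (nseq i x) :: nseq (n - i) x) = 0.
Proof.
move=> x1; have := @mu_relation K g n (fun=> 0) (fun=> x).
rewrite /shift_part add0r => /(_ (fun=> x1)) rel.
have neq0 (k : nat) : (k`!%:R : K) != 0.
  by rewrite ((pcharf0P K).1 charK0) -lt0n fact_gt0.
apply: (scalerI (neq0 n)); rewrite scaler0 -[RHS]rel scaler_sumr.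
apply: eq_bigr => i _; have i_n : (i <= n)%N by rewrite -ltnS.
rewrite scalerA -(bin_fact i_n) !natrM -mulrA mulrACA !divff // !mulr1.
have lists (P : pred 'I_n) : [seq x | k : 'I_n <- enum 'I_n & P k] =
    nseq (size (filter P (enum 'I_n))) x by elim: (filter _ _) => //= ? ? ->.
have size_tail : size [seq k : 'I_n <- enum 'I_n | (i <= k)%N] = (n - i)%N.
  have := count_predC (fun k : 'I_n => (k < i)%N) (enum 'I_n).
  rewrite -!size_filter size_filter_ord_ltn // -cardE card_ord.
  by rewrite (eq_filter (a2 := fun k : 'I_n => (i <= k)%N)) => [|k /=]; [lia | rewrite -leqNgt].
rewrite -card_unshuffle // scaler_nat -sumr_const; apply: eq_big => [s|s _].
  by rewrite inE.
rewrite !lists size_filter_ord_ltn // size_tail /koszul.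
by rewrite big1 ?scale1r // => a _; rewrite big1 // => b _; rewrite mulr0.
Qed.

(** Expanding [mc_trunc N x] gives a sum over the square [i, k < N]. Its part
    [i + k < N] vanishes, one antidiagonal at a time, by [mu_relation_diag]; on
    the rest each term has [i + k >= N] entries [x] in F_1 g. *)
Lemma bianchi_trunc (N : nat) (x : g) : part g 1 x ->
  F N%:Z (\sum_(k < N) (k`!%:R^-1 : K) *: mu g (mc_trunc N x :: nseq k x)).
Proof.
move=> x1; have subF := fil_subspace F N%:Z.
pose T i k := ((i`!%:R^-1 : K) * k`!%:R^-1) *: mu g (mu g (nseq i x) :: nseq k x).
have triangle0 (L : nat) : \sum_(i < L) \sum_(k < L - i) T i k = 0.
  elim: L => [|L IHL]; first by rewrite big_ord0.
  rewrite -[RHS](mu_relation_diag L x1) !big_ord_recr /= subSnn subnn big_ord1.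
  congr (_ + _); rewrite -[RHS]add0r -[X in _ = X + _]IHL -big_split /=.
  by apply: eq_bigr => i _; rewrite subSn ?big_ord_recr //= ltnW.
have -> : \sum_(k < N) (k`!%:R^-1 : K) *: mu g (mc_trunc N x :: nseq k x) =
    \sum_(i < N) \sum_(k < N) T i k.
  rewrite exchange_big; apply: eq_bigr => k _; rewrite mu_sum scaler_sumr.
  by apply: eq_bigr => i _; rewrite scalerA mulrC.
rewrite -[X in F _ X]subr0 -[X in _ - X](triangle0 N) -sumrB; apply: subspace_sum => // i _.
rewrite -!(big_mkord xpredT (T i)) (big_cat_nat (leq0n _) (leq_subr i N)) /=.
rewrite [X in F _ X]addrC addKr big_nat_cond.
apply: subspace_sum => // k; rewrite andbT => /andP[ik _]; apply: subspaceZ => //.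
apply: fil_anti (mu_fil_cons k (fil1T x) (mu_fil_nseq i x)); lia.
Qed.

(** The class of [z] is the set [z + Eden], which must be [Eden] and contains
    [z + 0]. *)
Lemma Epage_zero_boundary (s : nat) (p q : int) (z : g) :
  Epage_zero F s p q -> Enum F s p q z -> Eden F s p q z.
Proof.
move=> E0 Ez; have : Epage F s p q [set z + b | b in Eden F s p q]%classic by exists z.
rewrite E0 /= => <-; exists 0; last by rewrite addr0.
have mu0 := mu_nseq0 0; rewrite /= in mu0.
have fpart0 a b : fpart F a b 0.
  by split; apply: subspace0; [apply: fil_subspace | apply: part_subspace].
exists 0; first by rewrite /= mu0.
by exists 0; rewrite ?addr0 //; exists 0; rewrite //= mu0.
Qed.

(** * Improving approximate solutions *)

Variable r : nat.
Hypothesis E_zero : forall p q : int, p + q = 2 -> Epage_zero F r.+1 p q.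

(** The Bianchi identity makes the truncated series a cycle of the page r + 1. Its
    truncation order m + r + 1 is large enough for the identity to hold modulo
    F_(m+r+1). *)
Lemma mc_trunc_boundary (m : nat) (x : g) :
  part g 1 x -> F r.+1%:Z x -> F m%:Z (mc_trunc m x) ->
  exists y : g, [/\ part g 1 y, F (m%:Z - r%:Z) y &
    F m.+1%:Z (mc_trunc (m + r).+1 x - mu g [:: y])].
Proof.
move=> x1 Fx FR; set R := mc_trunc _ x.
have {}FR : F m%:Z R by apply: mc_trunc_fil FR; lia.
have R2 : part g 2 R by apply: mc_trunc_part.
have subF := fil_subspace F (m%:Z + r.+1%:Z).
have F_mu1R : F (m%:Z + r.+1%:Z) (mu g [:: R]).
  have := bianchi_trunc (m + r).+1 x1.
  rewrite big_ord_recl /= fact0 invr1 scale1r -/R => FB.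
  rewrite -[mu g _](addrK (\sum_(k < m + r) (k.+1`!%:R^-1 : K) *: mu g (R :: nseq k.+1 x))).
  apply: subspaceB => //; first by apply: fil_anti FB; lia.
  apply: subspace_sum => // k _; apply: subspaceZ => //.
  by apply: fil_anti (mu_fil_cons k.+1 Fx FR); rewrite mulrS; lia.
have mu1R3 : part g 3 (mu g [:: R]).
  have := @mu_part [:: 1] [:: R]; rewrite big_seq1; apply=> // -[|i] //.
have pq : m%:Z + (2 - m%:Z) = 2 by lia.
have := @Epage_zero_boundary r.+1 m%:Z (2 - m%:Z) R (E_zero pq).
rewrite /Enum /Eden pq => -[] //= z [[Fz _] _] [_ [y [[Fy y1] _] <-] zy].
exists y; split=> //; first by apply: fil_anti Fy; lia.
by rewrite -zy addrK; apply: fil_anti Fz; lia.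
Qed.

(** The new approximation is [x - y] with [y] from [mc_trunc_boundary]. Up to
    terms in F_(m+1), subtracting [y] only changes the series through mu_1; the
    bound [2 * r + 1 <= m] keeps [x - y] in F_(r+1). *)
Lemma mc_trunc_improve (m : nat) (x : g) :
  (2 * r + 1 <= m)%N -> part g 1 x -> F r.+1%:Z x -> F m%:Z (mc_trunc m x) ->
  exists x' : g, [/\ part g 1 x', F r.+1%:Z x', F (m%:Z - r%:Z) (x' - x) &
    F m.+1%:Z (mc_trunc m.+1 x')].
Proof.
move=> rm x1 Fx FR; have [y [y1 Fy FRy]] := mc_trunc_boundary x1 Fx FR.
have subF := fil_subspace F; exists (x - y).
have Fxy : F r.+1%:Z (x - y).
  by apply: subspaceB => //; apply: fil_anti Fy; lia.
have Fd : F (m%:Z - r%:Z) (x - y - x).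
  by rewrite [X in F _ X]addrC addKr; apply: subspaceN.
split=> //; first by apply: subspaceB => //; apply: part_subspace.
apply: (@mc_trunc_fil m.+1 (m + r).+1); [lia | lia |].
apply: (subspace_subK (subF _) _ FRy).
rewrite opprB addrCA addrC /mc_trunc -sumrB.
(* The terms of index 0 cancel; those of index 1 differ by - mu_1(y), which
   cancels the remaining mu_1(y). *)
have [N ->] : exists N, (m + r).+1 = N.+2 by exists (m + r).-1; lia.
rewrite !big_ord_recl /= subrr add0r invr1 !scale1r.
have -> : mu g [:: x - y] = mu g [:: x] - mu g [:: y].
  have := mu_linear [::] [::] (-1) y x; rewrite /= !scaleN1r.
  by rewrite [- y + x]addrC [X in _ = X]addrC.
rewrite addrAC [X in X + _ + _]addrC addKr addNr add0r.
apply: subspace_sum => // k _; rewrite -scalerBr; apply: subspaceZ => //.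
by apply: fil_anti (mu_fil_sub k.+1 Fxy Fx Fd); rewrite mulrS; lia.
Qed.

(** * The limit *)

Hypothesis curv : F (2 * r + 1)%N%:Z (mu g [::]).

Lemma mc_trunc_sequence : exists a : nat -> g, forall n,
  [/\ part g 1 (a n), F r.+1%:Z (a n), F n%:Z (a n.+1 - a n) &
    F n%:Z (mc_trunc (2 * r + 1 + n) (a n))].
Proof.
pose approx (n : nat) (x : g) := [/\ part g 1 x, F r.+1%:Z x &
  F (2 * r + 1 + n)%N%:Z (mc_trunc (2 * r + 1 + n) x)].
have /choice[next nextP] : forall nx : nat * g, exists x' : g,
    approx nx.1 nx.2 -> approx nx.1.+1 x' /\ F nx.1%:Z (x' - nx.2).
  move=> [n x] /=; have [[x1 Fx FR]|nax] := pselect (approx n x); last by exists 0.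
  have [//|x' [x'1 Fx' Fd FR']] := @mc_trunc_improve (2 * r + 1 + n) x _ x1 Fx FR.
    by rewrite leq_addr.
  exists x' => _; split; last by apply: fil_anti Fd; lia.
  by split; rewrite // addnS.
pose a := fix a n := if n is n'.+1 then next (n', a n') else 0.
have approx_a n : approx n (a n).
  elim: n => [|n IHn]; last by have [] := nextP (n, a n) IHn.
  split; [apply: subspace0; apply: part_subspace | apply: subspace0; apply: fil_subspace |].
  rewrite addn0 addn1 /mc_trunc big_ord_recl big1 => [|k _].
    by rewrite addr0 /= fact0 invr1 scale1r -addn1.
  by rewrite mu_nseq0 scaler0.
exists a => n; have [a1 Fa FR] := approx_a n; have [_ Fd] := nextP (n, a n) (approx_a n).
by split=> //; apply: fil_anti FR; lia.
Qed.

(** The limit [x] agrees with the n-th approximation modulo F_n, hence so do their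
    truncated series. *)
Lemma mc_exists : complete F -> exists x : g, MC F x /\ F (r + 1)%N%:Z x.
Proof.
move=> F_complete; have [a aP] := mc_trunc_sequence.
(* The sequence is extended to negative indices, where F_p g = g. *)
pose b (p : int) : g := if p is Posz n then a n else a 0%N.
have b1 p : part g 1 (b p) by case: p => n; [have [] := aP n | have [] := aP 0%N].
have Fb p : F p (b (p + 1) - b p).
  case: p => n; last by rewrite fil_bounded //; lia.
  by rewrite /b -PoszD addn1; have [] := aP n.
have [x [[x1 Fxb] _]] := F_complete 1 b b1 Fb.
have Fx : F r.+1%:Z x.
  by apply: (subspace_subK (fil_subspace F _) (Fxb r.+1%:Z)); have [] := aP r.+1.
exists x; split; last by rewrite addn1.
split=> // p; exists (2 * r + 1 + `|p|)%N => n n_large; rewrite subr0 -/(mc_trunc n x).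
have [_ Fa _ FR] := aP `|p|%N.
apply: (@fil_anti p `|p|%N%:Z); first lia.
have subF := fil_subspace F `|p|%N%:Z.
apply: (@subspace_subK _ _ _ subF _ (mc_trunc n (a `|p|%N))); last by apply: mc_trunc_fil FR; lia.
rewrite /mc_trunc -sumrB; apply: subspace_sum => // -[[|k] kn] _ /=.
  by rewrite subrr; apply: subspace0.
rewrite -scalerBr; apply: subspaceZ => //.
apply: fil_anti (mu_fil_sub k Fx Fa (Fxb `|p|%N%:Z)); lia.
Qed.

End Filtered.

Theorem theorem1p1 (K : fieldType) (charK0 : [pchar K] =i pred0)
    (g : curvedLinfty K) (F : filtration g)
    (F_complete : complete F) (F_compatible : compatible F)
    (r : nat) (curv : F (2 * r + 1)%N%:Z (mu g [::]))
    (E_zero : forall p q : int, p + q = 2 -> Epage_zero F r.+1 p q) :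
  exists alpha : g, MC F alpha /\ F (r + 1)%N%:Z alpha.
Proof. exact: (mc_exists F_compatible charK0 E_zero curv F_complete). Qed.
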